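(* For $k\ge0$ let $f_k=f_k(z)$ (resp. $g_k=g_k(z)$) be the generating function, with respect to the size, of grand zigzag knight's paths of altitude $k$ ending with $E$ or $N$ (resp. with $\bar E$ or $\bar N$), where the empty path is counted in $f_0$. Put $F(u)=\sum_{k\ge0}f_k(z)u^k$ and $G(u)=\sum_{k\ge0}g_k(z)u^k$. Let $$r=\frac{1-z^4-z^2-\sqrt{z^8-2z^6-z^4-2z^2+1}}{2z^3},\qquad s=\frac{1-z^4-z^2+\sqrt{z^8-2z^6-z^4-2z^2+1}}{2z^3}.$$ Then $$F(u)=\frac{-u^2-u(r+z)-z^2f_0s}{z^2(u-s)},\qquad G(u)=\frac{-z^2u-z^2f_0s+z^2s}{z^2(u-s)},\qquad\text{where } f_0=\frac{r(z-1)}{z^3(rz^2+z-1)}.$$ The bivariate generating function $H(u):=F(u)+G(u)$ for the number of grand zigzag knight's paths ending at a non-negative $y$-coordinate, with respect to the size (marked by $z$) and the altitude (marked by $u$), is $$H(u)=-\frac{u^2+u(r+z+z^2)+z^2s(2f_0-1)}{z^2(u-s)}.$$ The generating function (with respect to the size) for the total number of grand zigzag knight's paths ending at a non-negative $y$-coordinate is $$H(1)=-\frac{1+r+z+z^2+z^2s(2f_0-1)}{z^2(1-s)}.$$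
   Context: A grand zigzag knight's path is a lattice path in $\mathbb{Z}^2$ starting at the origin, made of steps $N=(1,2)$, $\bar N=(1,-2)$, $E=(2,1)$, $\bar E=(2,-1)$, such that the vertical components of two consecutive steps never have the same direction (up-steps $N,E$ and down-steps $\bar N,\bar E$ alternate); the empty path is allowed. The size is the $x$-coordinate of the last point and the altitude is the $y$-coordinate of the last point. The square root is the branch (power series in $z$) with value $1$ at $z=0$, so $r$ is a power series in $z$ with leading term $z^3$ and $s=1/r$ is a Laurent series; rational expressions in $u$ are expanded as power series in $u$. *)

(* Defs.v *)
From HB Require Import structures.
From mathcomp Require Import all_boot all_order all_algebra.
From mathcomp Require Import boolp.

Set Implicit Arguments.
Unset Strict Implicit.
Unset Printing Implicit Defensive.

Import Order.TTheory GRing.Theory Num.Theory.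
Local Open Scope ring_scope.

(* Formal power series in one variable: f n is the coefficient of degree n,
   multiplication is the Cauchy product. *)

Record fps (R : Type) := FPS { fps_coef :> nat -> R }.

Lemma fpsP (R : Type) (f g : fps R) : f =1 g <-> f = g.
Proof.
split=> [|-> //]; case: f g => [f] [g] /= fg.
by congr FPS; apply/funext.
Qed.

HB.instance Definition _ (R : Type) := gen_eqMixin (fps R).
HB.instance Definition _ (R : Type) := gen_choiceMixin (fps R).

(* strong recursion: srec F n = F n [:: srec F 0; ...; srec F n.-1] *)
Fixpoint srec_seq (R : Type) (F : nat -> seq R -> R) (n : nat) : seq R :=
  if n is m.+1 then rcons (srec_seq F m) (F m (srec_seq F m)) else [::].

Definition srec (R : Type) (F : nat -> seq R -> R) (n : nat) : R :=
  F n (srec_seq F n).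

Lemma size_srec_seq (R : Type) (F : nat -> seq R -> R) n :
  size (srec_seq F n) = n.
Proof. by elim: n => //= n IH; rewrite size_rcons IH. Qed.

Lemma nth_srec_seq (R : Type) (F : nat -> seq R -> R) x0 n i :
  (i < n)%N -> nth x0 (srec_seq F n) i = srec F i.
Proof.
elim: n => //= n IH; rewrite ltnS nth_rcons size_srec_seq leq_eqVlt.
by case/orP=> [/eqP->|lin]; rewrite ?ltnn ?eqxx // lin IH.
Qed.

Section Ring.
Variable R : comNzRingType.
Implicit Types f g h : fps R.

Definition fps0 : fps R := FPS (fun=> 0).
Definition fps_opp f : fps R := FPS (fun n => - f n).
Definition fps_add f g : fps R := FPS (fun n => f n + g n).

Let addA : associative fps_add.
Proof. by move=> f g h; apply/fpsP => n /=; rewrite addrA. Qed.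
Let addC : commutative fps_add.
Proof. by move=> f g; apply/fpsP => n /=; rewrite addrC. Qed.
Let add0 : left_id fps0 fps_add.
Proof. by move=> f; apply/fpsP => n /=; rewrite add0r. Qed.
Let addN : left_inverse fps0 fps_opp fps_add.
Proof. by move=> f; apply/fpsP => n /=; rewrite addNr. Qed.

HB.instance Definition _ := GRing.isZmodule.Build (fps R) addA addC add0 addN.

Definition fps1 : fps R := FPS (fun n => (n == 0%N)%:R).
Definition fps_mul f g : fps R :=
  FPS (fun n => \sum_(i < n.+1) f i * g (n - i)%N).

Let tr N f : {poly R} := \poly_(i < N.+1) f i.

Let trE N f i : (i <= N)%N -> (tr N f)`_i = f i.
Proof. by move=> iN; rewrite coef_poly ltnS iN. Qed.

Let mul_tr N f g n : (n <= N)%N -> (fps_mul f g) n = (tr N f * tr N g)`_n.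
Proof.
move=> nN; rewrite coefM; apply: eq_bigr => i _ /=.
have iN : (i <= N)%N by rewrite (leq_trans _ nN) // -ltnS.
by rewrite !trE // (leq_trans (leq_subr _ _)).
Qed.

Let mulA : associative fps_mul.
Proof.
move=> f g h; apply/fpsP => n; rewrite !(@mul_tr n) //.
transitivity (tr n f * tr n g * tr n h)`_n.
  rewrite -mulrA !coefM; apply: eq_bigr => i _; congr (_ * _).
  by rewrite trE ?leq_subr // (@mul_tr n) ?leq_subr.
rewrite !coefM; apply: eq_bigr => i _; congr (_ * _).
by rewrite trE -1?ltnS // (@mul_tr n) // -ltnS.
Qed.
Let mulC : commutative fps_mul.
Proof. by move=> f g; apply/fpsP => n; rewrite !(@mul_tr n) // mulrC. Qed.
Let mul1 : left_id fps1 fps_mul.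
Proof.
move=> f; apply/fpsP => n /=; rewrite big_ord_recl /= mul1r subn0.
by rewrite big1 ?addr0 // => i _; rewrite /= mul0r.
Qed.
Let mulD : left_distributive fps_mul fps_add.
Proof.
move=> f g h; apply/fpsP => n /=; rewrite -big_split /=.
by apply: eq_bigr => i _; rewrite mulrDl.
Qed.
Let fps1_neq0 : fps1 != 0.
Proof.
by apply/eqP => /fpsP /(_ 0%N) /= /eqP; rewrite oner_eq0.
Qed.

HB.instance Definition _ := GRing.Zmodule_isComNzRing.Build (fps R)
  mulA mulC mul1 mulD fps1_neq0.

Lemma fps_coef0 n : (0 : fps R) n = 0. Proof. by []. Qed.
Lemma fps_coefN f n : (- f) n = - f n. Proof. by []. Qed.
Lemma fps_coefD f g n : (f + g) n = f n + g n. Proof. by []. Qed.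
Lemma fps_coef1 n : (1 : fps R) n = (n == 0%N)%:R. Proof. by []. Qed.
Lemma fps_coefM f g n : (f * g) n = \sum_(i < n.+1) f i * g (n - i)%N.
Proof. by []. Qed.

Definition fpsC (c : R) : fps R := FPS (fun n => if n == 0%N then c else 0).
Definition fpsX : fps R := FPS (fun n => (n == 1%N)%:R).

End Ring.

Arguments fpsX {R}.
Notation "c %:S" := (fpsC c) (at level 1, format "c %:S") : ring_scope.

Section UnitRing.
Variable R : comUnitRingType.
Implicit Types f g : fps R.

Definition fps_unit : pred (fps R) := fun f => f 0%N \is a GRing.unit.

Definition fps_inv_rec f (n : nat) (g : seq R) : R :=
  (f 0%N)^-1 * ((n == 0%N)%:R - \sum_(i < n) g`_i * f (n - i)%N).

Definition fps_inv f : fps R :=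
  if fps_unit f then FPS (srec (fps_inv_rec f)) else f.

Let mulV : {in fps_unit, left_inverse 1 fps_inv *%R}.
Proof.
move=> f uf; have {}uf : fps_unit f := uf; apply/fpsP => n.
rewrite fps_coefM fps_coef1 big_ord_recr /= subnn /fps_inv uf /=.
rewrite {2}/srec /fps_inv_rec mulrAC mulVr // mul1r.
set t := \sum_(i < n) srec _ _ * _.
suff -> : \sum_(i < n) (srec_seq (fps_inv_rec f) n)`_i * f (n - i)%N = t.
  by rewrite addrC subrK.
by apply: eq_bigr => i _; rewrite nth_srec_seq.
Qed.
Let unitPl f g : g * f = 1 -> fps_unit f.
Proof.
move=> /fpsP /(_ 0%N); rewrite fps_coefM big_ord1 subnn /= => gf1.
by apply/unitrP; exists (g 0%N); rewrite [f 0%N * _]mulrC gf1.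
Qed.
Let inv_out : {in [predC fps_unit], fps_inv =1 id}.
Proof. by move=> f uf; rewrite /fps_inv ifN. Qed.

HB.instance Definition _ := GRing.ComNzRing_hasMulInverse.Build (fps R)
  mulV unitPl inv_out.

Lemma fps_unitE f : (f \is a GRing.unit) = (f 0%N \is a GRing.unit).
Proof. by []. Qed.

(* the square root with constant coefficient 1 *)
Definition fps_sqrt_rec f (n : nat) (g : seq R) : R :=
  if n == 0%N then 1
  else (f n - \sum_(1 <= i < n) g`_i * g`_(n - i)) / 2%:R.

Definition fps_sqrt f : fps R := FPS (srec (fps_sqrt_rec f)).

Lemma fps_sqrt0 f : fps_sqrt f 0%N = 1.
Proof. by []. Qed.

Lemma sqr_fps_sqrt f :
  (2%:R : R) \is a GRing.unit -> f 0%N = 1 -> fps_sqrt f ^+ 2 = f.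
Proof.
move=> u2 f0; apply/fpsP => -[|n]; rewrite expr2 fps_coefM.
  by rewrite big_ord1 subnn !fps_sqrt0 mulr1 f0.
have a0 : srec (fps_sqrt_rec f) 0 = 1 by [].
rewrite big_ord_recl big_ord_recr /= subnn subn0 a0 mulr1 mul1r.
set t := \sum_(i < n) _; set a := srec _ _.
suff -> : a = (f n.+1 - t) / 2%:R.
  rewrite addrCA -mulr2n -[X in _ + X]mulr_natr -mulrA mulVr // mulr1.
  by rewrite addrC subrK.
rewrite /a /srec /fps_sqrt_rec /=; congr ((_ - _) / _).
rewrite /t big_add1 /= big_mkord; apply: eq_bigr => i _.
rewrite -/(srec_seq (fps_sqrt_rec f) n.+1) !nth_srec_seq //.
  by rewrite subSS ltnS leq_subr.
by rewrite ltnS ltn_ord.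
Qed.

End UnitRing.

Section Idomain.
Variable R : idomainType.

Let fps_integral (f g : fps R) : f * g = 0 -> (f == 0) || (g == 0).
Proof.
have nz (h : fps R) : h != 0 -> exists n, h n != 0.
  move=> h0; apply: contrapT => H; case/eqP: h0; apply/fpsP => n.
  by apply/eqP; apply: contrapT => /negP hn; apply: H; exists n.
move=> fg0; apply: contrapT => /negP; rewrite negb_or => /andP[/nz ef /nz eg].
case: (ex_minnP ef) => m fm mf; case: (ex_minnP eg) => n gn ng.
move/fpsP: fg0 => /(_ (m + n)%N); rewrite fps_coefM fps_coef0.
have lt_m : (m < (m + n).+1)%N by rewrite ltnS leq_addr.
rewrite (bigD1 (Ordinal lt_m)) //= addKn big1 ?addr0.
  by move/eqP; rewrite mulf_eq0 (negbTE fm) (negbTE gn).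
move=> i; rewrite -val_eqE /= neq_ltn => /orP[im|mi].
  by have [->|/mf] := eqVneq (f i) 0; rewrite ?mul0r // leqNgt im.
have [->|/ng] := eqVneq (g (m + n - i)%N) 0; first by rewrite mulr0.
rewrite leqNgt; case/negP; rewrite ltn_subLR ?ltn_add2r //.
by rewrite -ltnS ltn_ord.
Qed.

HB.instance Definition _ :=
  GRing.ComUnitRing_isIntegral.Build (fps R) fps_integral.

End Idomain.

(* The fraction field of the power series in z over a field is the field of
   Laurent series in z. *)
Notation laurent := {fraction (fps rat)}.
Notation "x %:F" := (@FracField.tofrac _ x) : ring_scope.

(* In fps laurent the variable is u; a quotient whose denominator has nonzero
   constant coefficient (in laurent) is its power series expansion in u. *)

(* S is the value at u = 1 of a series H in u whose coefficients are power
   series in z: the partial sums of the coefficients converge z-adically,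
   that is, the coefficient of each z ^ n is eventually constant. *)
Definition value_at_1 (H : fps laurent) (S : laurent) : Prop :=
  exists (h : nat -> fps rat) (T : fps rat),
    [/\ forall k, H k = (h k)%:F,
        S = T%:F
      & forall n, exists M, forall m, (M <= m)%N ->
          (\sum_(k < m) h k) n = T n].

(* Nb and Eb stand for the barred steps. *)
Inductive step := N | Nb | E | Eb.

Definition step_vec (a : step) : int * int :=
  match a with
  | N => (1, 2) | Nb => (1, - 2) | E => (2, 1) | Eb => (2, - 1)
  end.

Definition step_code (a : step) : bool * bool :=
  match a with
  | N => (true, true) | Nb => (true, false)
  | E => (false, true) | Eb => (false, false)
  end.
Definition step_decode (c : bool * bool) : step :=
  match c with
  | (true, true) => N | (true, false) => Nb
  | (false, true) => E | (false, false) => Eb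
  end.
Lemma step_codeK : cancel step_code step_decode. Proof. by case. Qed.

HB.instance Definition _ := Finite.copy step (can_type step_codeK).

Definition up (a : step) : bool := 0 < (step_vec a).2.

(* grand zigzag knight's paths, as sequences of steps from the origin *)
Definition gzigzag (p : seq step) : bool :=
  sorted (fun a b => up a != up b) p.

Definition endpoint (p : seq step) : int * int := \sum_(a <- p) step_vec a.
Definition path_size (p : seq step) : int := (endpoint p).1.
Definition altitude (p : seq step) : int := (endpoint p).2.

Definition ends_in (A : seq step) (p : seq step) : bool :=
  if p is a :: q then last a q \in A else false.

(* Generating function, by size, of the paths satisfying P.  A path of size n
   has at most n steps (see size_le_path_size), so the paths of size n are
   among the sequences of n.-bseq step. *)
Definition path_gf (P : pred (seq step)) : fps rat :=
  FPS (fun n =>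
    #|[set p : n.-bseq step | [&& gzigzag p, path_size p == n%:Z & P p]]|%:R).

Lemma size_le_path_size (p : seq step) : (size p)%:Z <= path_size p.
Proof.
rewrite /path_size /endpoint; elim: p => [|a p IH]; first by rewrite big_nil.
rewrite big_cons [X in _ <= X]/= -[size (a :: p)]add1n PoszD lerD //.
by case: a.
Qed.

Definition f (k : nat) : fps rat :=
  path_gf (fun p => (altitude p == k%:Z)
                    && ((p == [::]) || ends_in [:: E; N] p)).
Definition g (k : nat) : fps rat :=
  path_gf (fun p => (altitude p == k%:Z) && ends_in [:: Eb; Nb] p).

Definition F : fps laurent := FPS (fun k => (f k)%:F).
Definition G : fps laurent := FPS (fun k => (g k)%:F).

Definition nonneg_gf2 : fps laurent :=
  FPS (fun k => (path_gf (fun p => altitude p == k%:Z))%:F).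
Definition nonneg_gf : laurent := (path_gf (fun p => 0 <= altitude p))%:F.

Definition z : laurent := fpsX%:F.
Definition u : fps laurent := fpsX.

Definition sqrt_delta : laurent :=
  (fps_sqrt (fpsX ^+ 8 - 2 * fpsX ^+ 6 - fpsX ^+ 4 - 2 * fpsX ^+ 2 + 1))%:F.
Definition r : laurent := (1 - z ^+ 4 - z ^+ 2 - sqrt_delta) / (2 * z ^+ 3).
Definition s : laurent := (1 - z ^+ 4 - z ^+ 2 + sqrt_delta) / (2 * z ^+ 3).

(* f_0, seen as a Laurent series *)
Definition f0 : laurent := (f 0)%:F.

(* Main.v *)
(* Over all altitudes in Z, removing the last step gives a linear system for
   the generating functions of the paths ending up and of those ending down,
   and the powers of z in it determine the solution uniquely.  Pairs of
   consecutive steps contribute W = z^2 + z^4 + z^3 (u + 1/u), and the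
   coefficient of u^k in 1 / (1 - W) is r^|k| / sqrt(Delta) because r and
   s = 1/r are the roots in u of u (1 - W).  Hence (g_k) is, up to the empty
   path, geometric of ratio r, and (f_k) is so from k = 2 on; multiplying by
   u - s leaves polynomials in u, and the value at u = 1 telescopes. *)

Require Import Defs.
From mathcomp Require Import all_boot all_order all_algebra.
From mathcomp Require Import ring.
Import Order.TTheory GRing.Theory Num.Theory.
Local Open Scope ring_scope.

(** * Coefficients of formal power series in one variable *)

Section Coefficients.
Variable R : comNzRingType.
Implicit Types (c d : R) (h : fps R).

Lemma fps_coefXnM (d : nat) h n :
  (fpsX ^+ d * h) n = if (d <= n)%N then h (n - d)%N else 0.
Proof.
elim: d n => [|d IH] n; first by rewrite expr0 mul1r subn0.
rewrite exprS -mulrA fps_coefM big_ord_recl /= mul0r add0r.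
case: n => [|n]; first by rewrite big_ord0.
rewrite big_ord_recl [X in _ + X]big1 ?addr0 => [|i _]; last first.
  by rewrite /= mul0r.
by rewrite [bump _ _]/= eqxx mul1r subn1 -fps_coefM IH ltnS.
Qed.

Lemma fps_coefXM h n : (fpsX * h) n = if n is m.+1 then h m else 0.
Proof. by rewrite -[fpsX]expr1 fps_coefXnM; case: n => // n; rewrite subn1. Qed.

Lemma fps_coefCM c h n : (c%:S * h) n = c * h n.
Proof.
rewrite fps_coefM big_ord_recl /= subn0 big1 ?addr0 // => i _.
by rewrite /= mul0r.
Qed.

Lemma fpsX_neq0 : fpsX != 0 :> fps R.
Proof. by apply/eqP => /fpsP /(_ 1%N) /eqP; rewrite fps_coef0 /= oner_eq0. Qed.

Lemma nat_fpsE (m n : nat) :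
  (m%:R : fps R) n = if n == 0%N then m%:R else 0.
Proof.
elim: m => [|m IH]; first by rewrite !mulr0n fps_coef0; case: eqP.
by rewrite -!natr1 fps_coefD IH fps_coef1; case: eqP; rewrite ?addr0.
Qed.

Lemma fps_coefXn (d n : nat) :
  (fpsX ^+ d : fps R) n = (n == d)%:R.
Proof.
rewrite -[fpsX ^+ d]mulr1 fps_coefXnM fps_coef1 subn_eq0 eqn_leq.
by case: leqP; rewrite ?andbT ?andbF.
Qed.

End Coefficients.

(** * Counting paths and removing the last step *)

(** The length bound is part of the type, so [h] has to match the counted sequences bijectively and
    also respect the two bounds. *)
Lemma card_bseq_map (T : finType) m n (P Q : pred (seq T))
    (h : seq T -> seq T) :
  injective h ->
  (forall p, (size p <= m)%N -> P p -> (size (h p) <= n)%N && Q (h p)) ->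
  (forall q, (size q <= n)%N -> Q q ->
     exists2 p, q = h p & (size p <= m)%N && P p) ->
  #|[set p : m.-bseq T | P p]| = #|[set q : n.-bseq T | Q q]|.
Proof.
move=> h_inj hPQ hQP.
pose H (p : m.-bseq T) : n.-bseq T := insub_bseq n (h p).
have HE (p : m.-bseq T) : P p -> H p = h p :> seq T.
  by move=> /(hPQ _ (size_bseq p))/andP[sz _]; rewrite /H insubdK.
rewrite -(card_in_imset (f := H)) => [|p q]; last first.
  rewrite !inE => Pp Pq /(congr1 (@bseqval _ _)) /=.
  by rewrite !HE // => /h_inj /val_inj.
apply: eq_card => q; rewrite inE; apply/imsetP/idP => [[p]|Qq].
  by rewrite inE => Pp ->; rewrite HE //; case/andP: (hPQ _ (size_bseq p) Pp).
have [p qE /andP[sz Pp]] := hQP _ (size_bseq q) Qq.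
have bE : insub_bseq m p = p :> seq T by rewrite insubdK.
exists (insub_bseq m p); first by rewrite inE bE.
by apply: val_inj; rewrite /= HE bE.
Qed.

Section PathGf.
Implicit Types (P Q : pred (seq step)) (p : seq step) (a : step).

Lemma eq_path_gf P Q : {in gzigzag, P =1 Q} -> path_gf P = path_gf Q.
Proof.
move=> PQ; apply/fpsP => n /=; congr (_%:R); apply: eq_card => p.
by rewrite !inE; case: (boolP (gzigzag p)) => //= /PQ ->.
Qed.

Lemma path_gfU P Q :
  (forall p, P p -> ~~ Q p) ->
  path_gf (fun p => P p || Q p) = path_gf P + path_gf Q.
Proof.
move=> PQ; apply/fpsP => n; rewrite fps_coefD /= -natrD; congr (_%:R).
rewrite -cardsUI [X in (_ + X)%N]eq_card0 ?addn0 => [|p].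
  by apply: eq_card => p; rewrite !inE -!andb_orr.
rewrite !inE; apply/negbTE/negP => /andP[/and3P[_ _ /PQ nQ] /and3P[_ _ Qp]].
by rewrite Qp in nQ.
Qed.

Lemma path_gf_false : path_gf (fun=> false) = 0.
Proof.
apply/fpsP => n /=; rewrite eq_card0 // => p.
by rewrite !inE !andbF.
Qed.

Lemma endpoint_rcons p a : endpoint (rcons p a) = endpoint p + step_vec a.
Proof. by rewrite /endpoint -cats1 big_cat big_seq1. Qed.

Lemma path_gf_nil : path_gf (fun p => p == [::]) = 1.
Proof.
apply/fpsP => n; rewrite fps_coef1 /=; congr (_%:R).
case: eqP => [->|/eqP n0]; last first.
  apply: eq_card0 => p; rewrite !inE.
  apply: contraNF n0 => /and3P[_ sz /eqP pE].
  by move: sz; rewrite pE /path_size /endpoint big_nil /= eq_sym eqz_nat.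
rewrite (eq_card1 (x := [bseq])) // => p; rewrite !inE -val_eqE /=.
case: (eqVneq (bseqval p) [::]) => [->|]; rewrite ?andbF //.
by rewrite /path_size /endpoint big_nil.
Qed.

Definition step_width a : nat := `|(step_vec a).1|.

Definition last_is a p := if p is b :: q then last b q == a else false.

(** True on the empty path, after which any step is allowed, so [gzigzag_rcons] needs no
    exception. *)
Definition last_up (b : bool) p :=
  if p is a :: q then up (last a q) == b else true.

Lemma gzigzag_rcons p a :
  gzigzag (rcons p a) = gzigzag p && last_up (~~ up a) p.
Proof.
case: p => //= b p; rewrite /gzigzag /= rcons_path; congr (_ && _).
by case: (up _); case: (up _).
Qed.

(** Removing the final step [a] lowers the size by its width and leaves a path that is empty or ends
    in the opposite direction. *)
Lemma path_gf_rcons P a :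
  path_gf (fun p => last_is a p && P p)
  = fpsX ^+ step_width a
    * path_gf (fun p => last_up (~~ up a) p && P (rcons p a)).
Proof.
apply/fpsP => n; rewrite fps_coefXnM /=.
have wE : (step_vec a).1 = step_width a :> int by case: a.
have w0 : (0 < step_width a)%N by case: a {wE}.
have szE p : path_size (rcons p a) = path_size p + step_width a.
  by rewrite /path_size endpoint_rcons /= wE.
have lastE q : last_is a q -> exists p, q = rcons p a.
  by case/lastP: q => // p b; case: p => [|c p] /=;
    rewrite ?last_rcons => /eqP->; [exists [::]|exists (c :: p)].
have lastT p : last_is a (rcons p a).
  by case: p => //= b p; rewrite last_rcons.
have [wn|nw] := leqP; last first.
  rewrite eq_card0 // => q; rewrite !inE; apply: contraTF nw.
  case/and4P=> _ /eqP sz /lastE[p qE] _; rewrite -leqNgt -lez_nat -sz qE szE.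
  by rewrite lerDr; apply: le_trans (size_le_path_size p).
congr (_%:R); apply/esym.
apply: (@card_bseq_map _ _ _
  (fun p => [&& gzigzag p, path_size p == (n - step_width a)%N,
                last_up (~~ up a) p & P (rcons p a)])
  (fun p => [&& gzigzag p, path_size p == n,
                last_is a p & P p])
  (rcons^~ a)).
- exact: rcons_injl.
- move=> p sp /and4P[gp /eqP sz lp Pp].
  rewrite size_rcons gzigzag_rcons gp lp lastT Pp szE sz.
  rewrite -PoszD subnK // eqxx !andbT.
  by apply: leq_ltn_trans sp _; rewrite ltn_subrL w0 (leq_trans w0 wn).
- move=> q sq /and4P[gq /eqP sz /lastE[p qE] Pq]; exists p => //.
  move: gq sz Pq; rewrite qE gzigzag_rcons szE => /andP[gp lp] sz Pp.
  have {}sz : path_size p = (n - step_width a)%N.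
    by rewrite -subzn // -sz addrK.
  (* The length of [p] is at most its size, which gives the tighter bound [n - step_width a]. *)
  by rewrite gp lp Pp sz eqxx !andbT -lez_nat -sz size_le_path_size.
Qed.

End PathGf.

(** * The linear system over all integer altitudes *)

(* The empty path is counted for both directions, which makes the two
   recurrences symmetric. *)
Definition dir_gf (b : bool) (k : int) : fps rat :=
  path_gf (fun p => (altitude p == k) && last_up b p).

Lemma last_up_or b (p : seq step) :
  last_up b p = (p == [::])
    || last_is (if b then N else Nb) p || last_is (if b then E else Eb) p.
Proof. by case: p => //= a q; case: (last a q); case: b. Qed.

Lemma dir_gf_rec b k :
  dir_gf b k = (k == 0)%:R
    + fpsX * dir_gf (~~ b) (k - (step_vec (if b then N else Nb)).2)
    + fpsX ^+ 2 * dir_gf (~~ b) (k - (step_vec (if b then E else Eb)).2).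
Proof.
pose alt (p : seq step) := altitude p == k.
have step_gf a : path_gf (fun p => last_is a p && alt p) =
    fpsX ^+ step_width a * dir_gf (~~ up a) (k - (step_vec a).2).
  rewrite path_gf_rcons; congr (_ * _); apply: eq_path_gf => p _.
  rewrite andbC /alt /altitude endpoint_rcons /=; congr (_ && _).
  by rewrite eq_sym -subr_eq eq_sym.
have nil_gf : path_gf (fun p => (p == [::]) && alt p) = (k == 0)%:R.
  case: (eqVneq k 0) => k0.
    rewrite mulr1n -path_gf_nil; apply: eq_path_gf => p _.
    case: eqP => [->|] //; rewrite /alt k0.
    by rewrite /altitude /endpoint big_nil.
  rewrite mulr0n -path_gf_false; apply: eq_path_gf => p _.
  case: eqP => [->|] //; rewrite /alt /altitude /endpoint big_nil /=.
  by rewrite eq_sym (negbTE k0).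
rewrite /dir_gf (@eq_path_gf _ (fun p => ((p == [::]) && alt p
    || last_is (if b then N else Nb) p && alt p)
    || last_is (if b then E else Eb) p && alt p)); last first.
  by move=> p _; rewrite andbC last_up_or !andb_orl.
rewrite !path_gfU => [|p|p]; first by rewrite nil_gf !step_gf; case: b.
- by case: p.
- by case: p => //= a q /andP[/eqP-> _]; case: b.
Qed.

(** The difference of two solutions satisfies the homogeneous system, where every term on the right
    has a factor z, so its coefficients vanish by induction on the degree. *)
Lemma dir_gf_uniq (A B : bool -> int -> fps rat) :
  (forall b k, A b k - B b k
     = fpsX * (A (~~ b) (k - (step_vec (if b then N else Nb)).2)
               - B (~~ b) (k - (step_vec (if b then N else Nb)).2))
     + fpsX ^+ 2 * (A (~~ b) (k - (step_vec (if b then E else Eb)).2)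
                    - B (~~ b) (k - (step_vec (if b then E else Eb)).2))) ->
  forall b k, A b k = B b k.
Proof.
move=> AB b k; apply/eqP; rewrite -subr_eq0; apply/eqP/fpsP => n.
elim/ltn_ind: n b k => n IH b k.
rewrite AB fps_coefD fps_coefXM fps_coefXnM fps_coef0.
case: n IH => [|n] IH; first by rewrite addr0.
rewrite IH // fps_coef0 add0r; case: ifP => // _.
by rewrite IH ?fps_coef0 // ltnS subSS leq_subr.
Qed.

(** * The power series of [r] and its quadratic equation *)

Lemma two_fps_neq0 : (2 : fps rat) != 0.
Proof. by apply/eqP => /fpsP /(_ 0%N); rewrite nat_fpsE. Qed.

Definition delta : fps rat :=
  fpsX ^+ 8 - 2 * fpsX ^+ 6 - fpsX ^+ 4 - 2 * fpsX ^+ 2 + 1.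
(* r and s are (r_mid -/+ delta_root) / (2 z^3). *)
Definition r_mid : fps rat := 1 - fpsX ^+ 4 - fpsX ^+ 2.
Definition delta_root : fps rat := fps_sqrt delta.

Lemma delta_coef0 : delta 0%N = 1.
Proof.
rewrite /delta !(fps_coefD, fps_coefN) -!(mulrC (_ ^+ _)) !fps_coefXnM.
by rewrite fps_coefXn fps_coefXn fps_coef1 /= !subr0 add0r.
Qed.

Lemma sqr_delta_root : delta_root ^+ 2 = delta.
Proof. by apply: sqr_fps_sqrt; rewrite ?delta_coef0. Qed.

Lemma delta_root_unit : delta_root \is a GRing.unit.
Proof. by rewrite fps_unitE. Qed.

Lemma r_mid_delta_root_unit : r_mid + delta_root \is a GRing.unit.
Proof. by rewrite fps_unitE !(fps_coefD, fps_coefN) !fps_coefXn. Qed.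

(* r_mid - delta_root is 4 z^6 / (r_mid + delta_root), where the denominator
   is invertible. *)
Lemma ex_r_ps :
  {a : fps rat | 2 * fpsX ^+ 3 * a = r_mid - delta_root & a 0%N = 0}.
Proof.
exists (2 * fpsX ^+ 3 / (r_mid + delta_root)).
  apply: (mulIr r_mid_delta_root_unit).
  rewrite mulrA mulrVK ?r_mid_delta_root_unit //.
  by rewrite -subr_sqr sqr_delta_root /delta /r_mid; ring.
by rewrite mulrAC mulrC fps_coefXnM.
Qed.

Definition r_ps : fps rat := s2val ex_r_ps.

Lemma r_psE : 2 * fpsX ^+ 3 * r_ps = r_mid - delta_root.
Proof. exact: s2valP ex_r_ps. Qed.

Lemma r_ps_coef0 : r_ps 0%N = 0.
Proof. exact: s2valP' ex_r_ps. Qed.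

(** This is u (1 - W) = 0 at u = r; after multiplication by 4 z^3 the root occurs only in a square
    and a linear term, which simplify with Delta. *)
Lemma r_ps_quadratic : fpsX ^+ 3 * (1 + r_ps ^+ 2) = r_mid * r_ps.
Proof.
have nz : 4 * fpsX ^+ 3 != 0 :> fps rat.
  rewrite (_ : 4 = 2 * 2) ?mulf_neq0 ?expf_neq0 ?fpsX_neq0 ?two_fps_neq0 //.
  by ring.
apply: (mulfI nz).
transitivity (4 * fpsX ^+ 6 + (2 * fpsX ^+ 3 * r_ps) ^+ 2); first by ring.
transitivity (2 * r_mid * (2 * fpsX ^+ 3 * r_ps)); last by ring.
rewrite r_psE sqrrB sqr_delta_root /delta /r_mid; ring.
Qed.

(** * The inverse of 1 - W *)

(* The coefficient of u^k in 1 / (1 - W), where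
   W = z^2 + z^4 + z^3 (u + 1/u) enumerates the pairs of an up-step and a
   down-step. *)
Definition walk_gf (k : int) : fps rat := delta_root^-1 * r_ps ^+ `|k|%N.

(** Equivalent to sqrt(Delta) = z^3 (s - r), the difference of the two roots; it removes the square
    root from the relations between the [f k]. *)
Lemma walk_gf_scale : fpsX ^+ 3 * (1 - r_ps ^+ 2) * delta_root^-1 = r_ps.
Proof.
apply: (canLR (mulrK delta_root_unit)).
transitivity (fpsX ^+ 3 * (1 + r_ps ^+ 2) - 2 * fpsX ^+ 3 * r_ps * r_ps).
  by ring.
by rewrite r_ps_quadratic r_psE; ring.
Qed.

Lemma walk_gfN k : walk_gf (- k) = walk_gf k.
Proof. by rewrite /walk_gf abszN. Qed.

Lemma walk_gf_nat (n : nat) : walk_gf n = delta_root^-1 * r_ps ^+ n.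
Proof. by []. Qed.

(** Coefficientwise, 1 - W times its inverse is 1. Nonzero k uses the quadratic equation; k = 0
    fixes the factor 1 / sqrt(Delta). *)
Lemma walk_gf_rec k : walk_gf k = (k == 0)%:R
  + (fpsX ^+ 2 + fpsX ^+ 4) * walk_gf k
  + fpsX ^+ 3 * (walk_gf (k - 1) + walk_gf (k + 1)).
Proof.
wlog k0 : k / 0 <= k => [H|].
  have [/H //|k0] := leP 0 k.
  have := H (- k); rewrite oppr_ge0 oppr_eq0 => /(_ (ltW k0)).
  rewrite -opprD (addrC (- k) 1) -[1 - k]opprB !walk_gfN => {1}->.
  by rewrite (addrC (walk_gf (k + 1))).
case: k k0 => // -[_|n _].
  rewrite sub0r walk_gfN add0r !walk_gf_nat expr0 eqxx.
  apply/eqP; rewrite -subr_eq0; apply/eqP.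
  apply: (mulIr delta_root_unit); rewrite mul0r.
  transitivity
    ((r_mid - 2 * fpsX ^+ 3 * r_ps) * (delta_root^-1 * delta_root) - delta_root).
    by rewrite mulr1n /r_mid; ring.
  by rewrite mulVr ?delta_root_unit // r_psE; ring.
have -> : walk_gf (n.+1%:Z - 1) = walk_gf n by rewrite subzn // subn1.
have -> : walk_gf (n.+1%:Z + 1) = walk_gf n.+2 by rewrite -PoszD addn1.
rewrite !walk_gf_nat add0r.
transitivity ((fpsX ^+ 2 + fpsX ^+ 4) * (delta_root^-1 * r_ps ^+ n.+1)
  + fpsX ^+ 3 * (1 + r_ps ^+ 2) * (delta_root^-1 * r_ps ^+ n));
  last by rewrite !exprS; ring.
by rewrite r_ps_quadratic /r_mid !exprS; ring.
Qed.

(** Cut a path into pairs from its end: the pairs give [walk_gf], and an odd length leaves one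
    initial step in the direction [b]. The proof instead checks that the right side solves the same
    system. *)
Lemma dir_gfE b k : dir_gf b k = walk_gf k
  + fpsX * walk_gf (k - (step_vec (if b then N else Nb)).2)
  + fpsX ^+ 2 * walk_gf (k - (step_vec (if b then E else Eb)).2).
Proof.
move: b k; apply: dir_gf_uniq => b k.
rewrite dir_gf_rec [X in _ - (X + _ + _)]walk_gf_rec.
case: b => /=.
  have -> : walk_gf (k - 2 - - 2) = walk_gf k by congr walk_gf; ring.
  have -> : walk_gf (k - 2 - - 1) = walk_gf (k - 1) by congr walk_gf; ring.
  have -> : walk_gf (k - 1 - - 2) = walk_gf (k + 1) by congr walk_gf; ring.
  have -> : walk_gf (k - 1 - - 1) = walk_gf k by congr walk_gf; ring.
  ring.
have -> : walk_gf (k - - 2 - 2) = walk_gf k by congr walk_gf; ring.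
have -> : walk_gf (k - - 2 - 1) = walk_gf (k + 1) by congr walk_gf; ring.
have -> : walk_gf (k - - 1 - 2) = walk_gf (k - 1) by congr walk_gf; ring.
have -> : walk_gf (k - - 1 - 1) = walk_gf k by congr walk_gf; ring.
ring.
Qed.

(** * Formulas for [f k] and [g k] *)

Lemma f_dir k : f k = dir_gf true k.
Proof.
apply: eq_path_gf => -[|a p] _ //=; congr (_ && _).
by rewrite !inE; case: (last a p).
Qed.

(** [last_up] accepts the empty path but [ends_in] rejects it, hence the correction at k = 0. *)
Lemma g_dir k : g k + (k == 0%N)%:R = dir_gf false k.
Proof.
rewrite /dir_gf (@eq_path_gf _ (fun p =>
  (altitude p == k) && ends_in [:: Eb; Nb] p || (k == 0%N) && (p == [::]))).
  rewrite path_gfU; last by case => [|a p]; rewrite !andbF.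
  congr (_ + _); case: eqP => _; first by rewrite path_gf_nil.
  by rewrite path_gf_false.
case=> [|a p] _; rewrite !(andbF, orbF, andbT) /=.
  by rewrite /altitude /endpoint big_nil eqz_nat eq_sym.
by congr (_ && _); rewrite !inE; case: (last a p).
Qed.

Lemma nonneg_gf2_split k :
  path_gf (fun p => altitude p == k%:Z) = f k + g k.
Proof.
rewrite -path_gfU => [|[|a p]]; last 2 first.
- by rewrite andbF.
- rewrite /= !inE; case: (altitude _ == _) => //=.
  by case: (last a p).
apply: eq_path_gf => -[|a p] _; rewrite -andb_orr ?andbT //=.
by rewrite !inE; case: (last a p); rewrite ?andbT.
Qed.

Lemma f0_walk : f 0 = delta_root^-1 * (1 + fpsX * r_ps ^+ 2 + fpsX ^+ 2 * r_ps).
Proof.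
rewrite f_dir dir_gfE /= !sub0r !walk_gfN !walk_gf_nat; ring.
Qed.

Lemma f1_walk : f 1 = delta_root^-1 * (r_ps + fpsX * r_ps + fpsX ^+ 2).
Proof.
rewrite f_dir dir_gfE /= subrr.
have -> : walk_gf (1%:Z - 2) = walk_gf 1 by rewrite -walk_gfN opprB.
rewrite !walk_gf_nat; ring.
Qed.

(** From altitude 2 on, the arguments of [walk_gf] in [dir_gfE] are nonnegative, so the absolute
    values disappear and a power of r factors out. *)
Lemma fSS_walk k :
  f k.+2 = delta_root^-1 * r_ps ^+ k * (r_ps ^+ 2 + fpsX + fpsX ^+ 2 * r_ps).
Proof.
rewrite f_dir dir_gfE /=.
have -> : walk_gf (k.+2%:Z - 2) = walk_gf k by rewrite subzn // subn2.
have -> : walk_gf (k.+2%:Z - 1) = walk_gf k.+1 by rewrite subzn // subn1.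
rewrite !walk_gf_nat !exprS; ring.
Qed.

(** Paths ending down only involve [walk_gf] at k, k + 1 and k + 2, so the geometric form holds from
    k = 0; the empty path is subtracted. *)
Lemma g_geometric k : g k = f 0 * r_ps ^+ k - (k == 0%N)%:R.
Proof.
apply/eqP; rewrite eq_sym subr_eq eq_sym g_dir f0_walk dir_gfE /=; apply/eqP.
have -> : walk_gf (k%:Z - - 2) = walk_gf k.+2 by rewrite opprK -PoszD addn2.
have -> : walk_gf (k%:Z - - 1) = walk_gf k.+1 by rewrite opprK -PoszD addn1.
rewrite !walk_gf_nat !exprS; ring.
Qed.

(** The defect of [f] from ratio r at rank 1; with [f2_recE] it yields the coefficients of u and u^2
    in the numerator of F. *)
Lemma f1_recE : fpsX ^+ 2 * (f 1 - r_ps * f 0) = r_ps * (r_ps + fpsX).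
Proof.
transitivity (fpsX ^+ 3 * (1 - r_ps ^+ 2) * delta_root^-1 * (r_ps + fpsX)).
  by rewrite f0_walk f1_walk; ring.
by rewrite walk_gf_scale.
Qed.

Lemma f2_recE : fpsX ^+ 2 * (f 2 - r_ps * f 1) = r_ps.
Proof. by rewrite -[RHS]walk_gf_scale fSS_walk f1_walk; ring. Qed.

Lemma f_recE k : f k.+3 = r_ps * f k.+2.
Proof. by rewrite !fSS_walk exprS; ring. Qed.

Lemma f0_eq :
  fpsX ^+ 3 * (r_ps * fpsX ^+ 2 + fpsX - 1) * f 0 = r_ps * (fpsX - 1).
Proof.
(* The second summand is a multiple of the quadratic equation of r, hence zero. *)
transitivity (fpsX ^+ 3 * (1 - r_ps ^+ 2) * delta_root^-1 * (fpsX - 1)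
  + delta_root^-1 * fpsX ^+ 3 * r_ps
    * (fpsX ^+ 3 * (1 + r_ps ^+ 2) - r_mid * r_ps)).
  by rewrite f0_walk /r_mid; ring.
by rewrite r_ps_quadratic walk_gf_scale; ring.
Qed.

(** * Sums over nonnegative altitudes *)

(** Each step rises by at most twice its width, so altitudes above 2 n do not contribute to the
    coefficient of z^n. *)
Lemma altitude_le (p : seq step) : altitude p <= 2 * path_size p.
Proof.
elim/last_ind: p => [|p a IH].
  by rewrite /altitude /path_size /endpoint big_nil.
rewrite /altitude /path_size endpoint_rcons /= mulrDr lerD //.
by case: a.
Qed.

Lemma sum_altitude_gf m :
  \sum_(k < m) path_gf (fun p => altitude p == k%:Z)
  = path_gf (fun p => 0 <= altitude p < m%:Z).
Proof.
elim: m => [|m IH].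
  rewrite big_ord0 -path_gf_false; apply: eq_path_gf => p _.
  by case: ltgtP.
rewrite big_ord_recr /= IH -path_gfU => [|p]; last first.
  by case/andP=> _; rewrite lt_neqAle => /andP[].
apply: eq_path_gf => p _; rewrite -addn1 PoszD ltzD1 [_ <= m%:Z]le_eqVlt.
by case: (eqVneq (altitude p) m) => [->|_]; rewrite ?orbT ?orbF.
Qed.

Lemma sum_altitude_gf_coef n m : (n.*2 < m)%N ->
  (\sum_(k < m) path_gf (fun p => altitude p == k%:Z)) n
  = path_gf (fun p => 0 <= altitude p) n.
Proof.
move=> nm; rewrite sum_altitude_gf /=; congr (_%:R); apply: eq_card => p.
rewrite !inE; case: gzigzag => //=; case: eqP => //= sz.
rewrite andb_idr // => _; apply: le_lt_trans (altitude_le p) _.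
by rewrite sz -PoszM ltz_nat mul2n.
Qed.

(* Telescoping a sequence which is geometric from rank 2 on; the identity
   survives the z-adic limit of the partial sums. *)
Lemma eventual_sum_geometric (h : nat -> fps rat) (T a : fps rat) :
  (forall k, h k.+3 = a * h k.+2) ->
  (forall n, exists M, forall m, (M <= m)%N -> (\sum_(k < m) h k) n = T n) ->
  (1 - a) * T = h 0 + (h 1 - a * h 0) + (h 2 - a * h 1).
Proof.
move=> hS hT; set c := RHS.
pose P m := \sum_(k < m) h k.
have PE m : P m.+1 = P m + h m by rewrite /P big_ord_recr.
have PS m : P m.+3 - a * P m.+2 = c.
  elim: m => [|m IH].
    by rewrite !PE /P big_ord0 /c; ring.
  by rewrite -IH (PE m.+3) (PE m.+2) hS; ring.
apply/fpsP => n.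
(* A coefficient of the product with [a] involves all lower degrees, so the partial sums must be
   stable in every degree up to n at once. *)
have [M PM] : exists M, forall i m, (i <= n)%N -> (M <= m)%N -> P m i = T i.
  elim: n => [|n [M PM]].
    have [M PM] := hT 0%N; exists M => i m.
    by rewrite leqn0 => /eqP->; apply: PM.
  have [M' PM'] := hT n.+1; exists (maxn M M') => i m.
  rewrite geq_max leq_eqVlt => /orP[/eqP->|lin] /andP[Mm M'm]; first exact: PM'.
  exact: PM.
rewrite -(PS M) mulrBl mul1r !(fps_coefD, fps_coefN) PM //; last first.
  by rewrite -addn3 leq_addr.
congr (_ - _); rewrite !fps_coefM; apply: eq_bigr => i _.
by rewrite PM ?leq_subr // -addn2 leq_addr.
Qed.

(** * Passage to Laurent series *)

Lemma z_neq0 : z != 0.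
Proof. by rewrite tofrac_eq0 fpsX_neq0. Qed.

Lemma two_laurent_neq0 : 2 != 0 :> laurent.
Proof.
by rewrite -(rmorph_nat (@FracField.tofrac (fps rat))) tofrac_eq0 two_fps_neq0.
Qed.

Lemma r_mid_tofrac : r_mid%:F = 1 - z ^+ 4 - z ^+ 2.
Proof. by rewrite !rmorphB rmorph1 !rmorphXn. Qed.

Lemma r_ps_laurent : 2 * z ^+ 3 * r_ps%:F = 1 - z ^+ 4 - z ^+ 2 - sqrt_delta.
Proof.
by rewrite -r_mid_tofrac -tofracB -r_psE 2!rmorphM rmorphXn rmorph_nat.
Qed.

Lemma r_tofrac : r = r_ps%:F.
Proof.
rewrite /r -r_ps_laurent mulrAC mulfV ?mul1r //.
by rewrite mulf_neq0 ?expf_neq0 ?two_laurent_neq0 ?z_neq0.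
Qed.

(** The product of the two conjugate numerators is [r_mid ^+ 2] - Delta = 4 z^6. *)
Lemma mul_rs : r * s = 1.
Proof.
have nz : 2 * z ^+ 3 != 0.
  by rewrite mulf_neq0 ?expf_neq0 ?two_laurent_neq0 ?z_neq0.
rewrite /r /s -r_mid_tofrac mulf_div -subr_sqr.
have <- : (r_mid ^+ 2 - delta_root ^+ 2)%:F = r_mid%:F ^+ 2 - sqrt_delta ^+ 2.
  by rewrite rmorphB !rmorphXn.
have -> : r_mid ^+ 2 - delta_root ^+ 2 = (2 * fpsX ^+ 3) ^+ 2.
  by rewrite sqr_delta_root /r_mid /delta; ring.
rewrite rmorphXn rmorphM rmorphXn rmorph_nat -expr2.
by rewrite divff ?expf_neq0.
Qed.

Lemma r_neq0 : r != 0.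
Proof.
apply/eqP => r0; have /eqP := mul_rs.
by rewrite r0 mul0r eq_sym oner_eq0.
Qed.

Lemma sE : s = r^-1.
Proof. by rewrite -[RHS]mulr1 -mul_rs mulKf ?r_neq0. Qed.

Lemma one_sub_r_neq0 : 1 - r != 0.
Proof.
rewrite r_tofrac -tofrac1 -tofracB tofrac_eq0; apply/eqP => /fpsP/(_ 0%N).
by rewrite fps_coefD fps_coefN r_ps_coef0 fps_coef0.
Qed.

Lemma denominator_f0_neq0 : r * z ^+ 2 + z - 1 != 0.
Proof.
rewrite r_tofrac -tofracXn -tofracM -tofrac1 -tofracD -tofracB tofrac_eq0.
apply/eqP => /fpsP/(_ 0%N).
by rewrite !(fps_coefD, fps_coefN) mulrC fps_coefXnM.
Qed.

Definition fz k : laurent := (f k)%:F.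
Definition gz k : laurent := (g k)%:F.

Lemma gz_geometric k : gz k = f0 * r ^+ k - (k == 0%N)%:R.
Proof.
by rewrite /gz g_geometric rmorphB rmorphM rmorphXn rmorph_nat r_tofrac.
Qed.

Lemma fz1E : z ^+ 2 * (fz 1 - r * f0) = r * (r + z).
Proof.
rewrite r_tofrac -tofracXn -!tofracM -tofracB -tofracM f1_recE.
by rewrite rmorphM rmorphD.
Qed.

Lemma fz2E : z ^+ 2 * (fz 2 - r * fz 1) = r.
Proof.
by rewrite r_tofrac -tofracXn -!tofracM -tofracB -tofracM f2_recE.
Qed.

Lemma fz_recE k : fz k.+3 = r * fz k.+2.
Proof. by rewrite /fz f_recE rmorphM r_tofrac. Qed.

Lemma f0_closed : f0 = r * (z - 1) / (z ^+ 3 * (r * z ^+ 2 + z - 1)).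
Proof.
have dn : z ^+ 3 * (r * z ^+ 2 + z - 1) != 0.
  by rewrite mulf_neq0 ?expf_neq0 ?z_neq0 ?denominator_f0_neq0.
apply: (canRL (mulfK dn)); rewrite mulrC.
rewrite r_tofrac /f0 -!tofracXn -!tofracM -tofrac1 -tofracD -!tofracB.
by rewrite -!tofracM f0_eq.
Qed.

(** * Closed forms in u *)

(** The constant coefficient - z^2 s is nonzero, so division by the denominator is expansion in
    powers of u. *)
Lemma denominator_unit : (z ^+ 2)%:S * (u - s%:S) \is a GRing.unit.
Proof.
rewrite fps_unitE fps_coefCM fps_coefD fps_coefN /= sub0r unitfE.
by rewrite mulf_neq0 ?expf_neq0 ?z_neq0 // oppr_eq0 sE invr_eq0 r_neq0.
Qed.

(** For n > 0 this is [h n] - r [h n.-1] up to the factor - z^2 s when r s = 1: multiplying by u - s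
    measures the failure to be geometric of ratio r. *)
Lemma mul_denominator_coef (h : fps laurent) n :
  (h * ((z ^+ 2)%:S * (u - s%:S))) n
  = z ^+ 2 * ((if n is m.+1 then h m else 0) - s * h n).
Proof.
rewrite mulrCA fps_coefCM mulrBr fps_coefD fps_coefN.
by rewrite (mulrC h u) (mulrC h) fps_coefXM fps_coefCM.
Qed.

Lemma F_closed : F = (- u ^+ 2 - u * (r + z)%:S - (z ^+ 2 * f0 * s)%:S)
       / ((z ^+ 2)%:S * (u - s%:S)).
Proof.
apply: (canRL (mulrK denominator_unit)); apply/fpsP => n.
rewrite mul_denominator_coef !(fps_coefD, fps_coefN) fps_coefXn fps_coefXM.
rewrite ![fps_coef F _]/= -!/(fz _).
(* Multiplying by [r] turns r s into 1; degrees 1 and 2 then reduce to the defects of [f], and the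
   defect vanishes from degree 3 on. *)
apply: (mulfI r_neq0).
case: n => [|[|[|n]]] /=; rewrite -!/(fz _) -/f0.
- by ring.
- transitivity (- (z ^+ 2 * (fz 1 - r * f0))); first by ring: mul_rs.
  by rewrite fz1E ?mulr0n; ring.
- transitivity (- (z ^+ 2 * (fz 2 - r * fz 1))); first by ring: mul_rs.
  by rewrite fz2E; ring.
by rewrite fz_recE; ring: mul_rs.
Qed.

Lemma G_closed :
  G = (- ((z ^+ 2)%:S * u) - (z ^+ 2 * f0 * s)%:S + (z ^+ 2 * s)%:S)
          / ((z ^+ 2)%:S * (u - s%:S)).
Proof.
apply: (canRL (mulrK denominator_unit)); apply/fpsP => n.
rewrite mul_denominator_coef !(fps_coefD, fps_coefN) fps_coefCM.
by case: n => [|[|n]] /=; rewrite -!/(gz _) !gz_geometric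
  ?exprS ?expr0 ?mulr1n ?mulr0n; ring: mul_rs.
Qed.

Lemma H_closed : F + G = - ((u ^+ 2 + u * (r + z + z ^+ 2)%:S
               + (z ^+ 2 * s * (2 * f0 - 1))%:S)
              / ((z ^+ 2)%:S * (u - s%:S))).
Proof.
rewrite F_closed G_closed -mulrDl -[RHS]mulNr; congr (_ / _).
apply/fpsP => n.
rewrite !(fps_coefD, fps_coefN) fps_coefXn !fps_coefXM fps_coefCM.
by case: n => [|[|[|n]]] /=; rewrite ?mulr1n ?mulr0n; ring.
Qed.

Lemma F_add_G : F + G = nonneg_gf2.
Proof.
by apply/fpsP => k; rewrite fps_coefD /= nonneg_gf2_split rmorphD.
Qed.

(** * The value at u = 1 *)

Lemma nonneg_gf_value : value_at_1 (F + G) nonneg_gf.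
Proof.
rewrite F_add_G; exists (fun k => path_gf (fun p => altitude p == k%:Z)).
exists (path_gf (fun p => 0 <= altitude p)); split=> // n.
by exists n.*2.+1 => m; apply: sum_altitude_gf_coef.
Qed.

(** The value comes from telescoping f + g, geometric from rank 2 on, rather than from setting u = 1
    in [H_closed]. *)
Lemma nonneg_gf_closed : nonneg_gf
  = - ((1 + r + z + z ^+ 2 + z ^+ 2 * s * (2 * f0 - 1)) / (z ^+ 2 * (1 - s))).
Proof.
pose h k := fz k + gz k.
have hE : z ^+ 2 * ((1 - r) * nonneg_gf)
    = z ^+ 2 * (h 0%N + (h 1%N - r * h 0%N) + (h 2%N - r * h 1%N)).
  congr (_ * _); rewrite /nonneg_gf r_tofrac -tofrac1 -tofracB -tofracM.
  rewrite (@eventual_sum_geometric (fun k => f k + g k)) => [|k|n].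
  - rewrite /h /fz /gz; move: (f 0) (g 0) (f 1) (g 1) (f 2) (g 2) r_ps => *.
    by rewrite !(tofracD, tofracN, tofracM).
  - by rewrite f_recE !g_geometric !exprS /= !mulr0n; ring.
  exists n.*2.+1 => m nm; rewrite -(@sum_altitude_gf_coef n m nm).
  congr (fps_coef _ n).
  by apply: eq_bigr => k _; rewrite nonneg_gf2_split.
have {}hE : z ^+ 2 * ((1 - r) * nonneg_gf)
    = z ^+ 2 * (2 * f0 - 1) + r * (r + z) + z ^+ 2 * r + r.
  rewrite hE -fz1E -[X in _ = _ + X]fz2E /h !gz_geometric -[fz 0]/f0.
  by rewrite !mulr0n mulr1n; ring.
(* This exchanges the factor 1 - r of the telescoped sum for the 1 - s of the denominator. *)
have s_eq : r * (1 - s) = - (1 - r) by ring: mul_rs.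
have dn : z ^+ 2 * (1 - s) != 0.
  rewrite mulf_neq0 ?expf_neq0 ?z_neq0 //.
  apply: contraNneq one_sub_r_neq0 => s1.
  by rewrite -oppr_eq0 -s_eq s1 mulr0.
rewrite -mulNr; apply: (canRL (mulfK dn)); apply: (mulfI r_neq0).
transitivity (- (z ^+ 2 * ((1 - r) * nonneg_gf))); first by ring: mul_rs.
rewrite hE; ring: mul_rs.
Qed.

Theorem theorem3p1 :
  (F = (- u ^+ 2 - u * (r + z)%:S - (z ^+ 2 * f0 * s)%:S)
       / ((z ^+ 2)%:S * (u - s%:S))
   /\ G = (- ((z ^+ 2)%:S * u) - (z ^+ 2 * f0 * s)%:S + (z ^+ 2 * s)%:S)
          / ((z ^+ 2)%:S * (u - s%:S))
   /\ f0 = r * (z - 1) / (z ^+ 3 * (r * z ^+ 2 + z - 1)))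
  /\
  (let H := F + G in
   (H = nonneg_gf2
    /\ H = - ((u ^+ 2 + u * (r + z + z ^+ 2)%:S
               + (z ^+ 2 * s * (2 * f0 - 1))%:S)
              / ((z ^+ 2)%:S * (u - s%:S))))
   /\
   (value_at_1 H nonneg_gf
    /\ nonneg_gf = - ((1 + r + z + z ^+ 2 + z ^+ 2 * s * (2 * f0 - 1))
                      / (z ^+ 2 * (1 - s))))).
Proof.
split.
  by split; [exact: F_closed | split; [exact: G_closed | exact: f0_closed]].
split; first by split; [exact: F_add_G | exact: H_closed].
by split; [exact: nonneg_gf_value | exact: nonneg_gf_closed].
Qed.
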